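(* Let $p$ be an odd prime, let $g$ be a primitive root modulo $p^2$, and let $a,b,c$ be integers with $p\nmid abc$. Define $$F(p;a,b,c) = 1-\frac{2}{p}+\frac{1}{p^2}\sum_{\ell=1}^{p} H_p(ag^{\ell})\,H_p(bg^{\ell})\,H_p(cg^{\ell}).$$ Then $F(p;a,b,c)$ is a nonnegative integer, and the number of solutions $(x,y,z)\in(\mathbb{Z}/p^2\mathbb{Z})^3$ to the congruence $$ax^p+by^p\equiv cz^p \pmod{p^2}$$ which satisfy $p\nmid xyz$ is precisely $p^3(p-1)F(p;a,b,c)$. In particular, if $F(p;a,b,c)=0$, then the equation $ax^p+by^p=cz^p$ has no solutions in integers $x,y,z$ with $p\nmid xyz$.
   Context: For real $x$, $e(x)=\exp(2\pi i x)$. For an odd prime $p$ and an integer $a$, the Heilbronn sum is $$H_p(a)=\sum_{\ell=1}^{p-1} e\left(\frac{a\ell^p}{p^2}\right).$$ It depends only on $a$ modulo $p^2$. *)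

(* Defs.v *)
From mathcomp Require Import all_boot all_order all_fingroup all_algebra all_solvable.
From mathcomp Require Import complex.
From mathcomp Require Import reals trigo.

Set Implicit Arguments.
Unset Strict Implicit.
Unset Printing Implicit Defensive.

Import Order.TTheory GRing.Theory Num.Theory.
Local Open Scope ring_scope.
Local Open Scope complex_scope.

(* e(x) = exp(2 pi i x), written by Euler's formula: the complex exponential is
   not available on R[i]. *)
Definition e (R : realType) (x : R) : R[i] :=
  cos (2 * pi * x) +i* sin (2 * pi * x).

Definition heilbronn (R : realType) (p : nat) (a : int) : R[i] :=
  \sum_(1 <= l < p) e ((a * l%:Z ^+ p)%:~R / (p%:R ^+ 2) : R).

(* To be used with 1 < n only, because of the encoding of 'Z_n. *)
Definition primitive_root_mod (n : nat) (g : int) : Prop :=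
  exists2 u : {unit 'Z_n},
    FinRing.uval u = g%:~R & generator [set: {unit 'Z_n}] u.

Definition F (R : realType) (p : nat) (g a b c : int) : R[i] :=
  1 - 2 / p%:R + (p%:R ^+ 2)^-1 *
    \sum_(1 <= l < p.+1) heilbronn R p (a * g ^+ l)
                         * heilbronn R p (b * g ^+ l)
                         * heilbronn R p (c * g ^+ l).

(* Since p %| p ^ 2, divisibility by p can be tested on the representatives in
   [0, p ^ 2). *)
Definition solutions (p : nat) (a b c : int) :
    {set 'Z_(p ^ 2) * 'Z_(p ^ 2) * 'Z_(p ^ 2)} :=
  [set t : 'Z_(p ^ 2) * 'Z_(p ^ 2) * 'Z_(p ^ 2) |
    let: (x, y, z) := t in
    (a%:~R * x ^+ p + b%:~R * y ^+ p == c%:~R * z ^+ p)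
    && ~~ (p %| (x : nat) * (y : nat) * (z : nat))%N].

(* Main.v *)
(* The function H (k) = \sum_(1 <= l < p) e (k l ^ p / p ^ 2) on Z/p^2 satisfies
   p H (k) = \sum_(x unit) e (k x ^ p / p ^ 2), because (l + p j) ^ p = l ^ p
   mod p^2. Hence H is invariant under multiplication by p-th powers of units,
   and orthogonality of characters gives
     p^3 \sum_k H (a k) H (b k) H (c k) = p^2 #solutions,
   the sign of c being absorbed by z -> -z. Splitting k into 0, nonzero
   multiples of p and units g ^ i evaluates the left-hand side as
   p^5 (p - 1) F. *)
Require Import Defs.
From mathcomp Require Import all_boot all_order all_fingroup all_algebra all_solvable.
From mathcomp Require Import complex.
From mathcomp Require Import reals trigo.
From mathcomp Require Import ring.

Set Implicit Arguments.
Unset Strict Implicit.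
Unset Printing Implicit Defensive.

Import Order.TTheory GRing.Theory Num.Theory.
Local Open Scope ring_scope.
Local Open Scope complex_scope.

(** * Additive characters of ['Z_n] and their orthogonality *)

Section AdditiveCharacter.
Variable R : realType.

Lemma eD (x y : R) : e (x + y) = e x * e y.
Proof.
rewrite /e; simpc; rewrite mulrDr cosD sinD.
by congr (_ +i* _); rewrite addrC [X in _ + X]mulrC.
Qed.

Lemma e0 : e (0 : R) = 1.
Proof. by rewrite /e mulr0 cos0 sin0. Qed.

Lemma e1 : e (1 : R) = 1.
Proof. by rewrite /e mulr1 mulr_natl cos2pi sin2pi. Qed.

Lemma e_nat (n : nat) : e (n%:R : R) = 1.
Proof. by elim: n => [|n IH]; rewrite ?e0 // -natr1 eD IH e1 mulr1. Qed.

(** The double-angle formula turns cos (2 pi x) = 1 into cos (pi x)^2 = 1, hence sin (pi x) = 0, but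
    the sine is positive between 0 and pi. *)
Lemma e_neq1 (x : R) : 0 < x < 1 -> e x != 1.
Proof.
case/andP=> x_gt0 x_lt1; apply/negP => /eqP[].
rewrite mulr_natl mulrnAl cos_mulr2n => cosx _.
have := cos2Dsin2 (pi * x); have -> : cos (pi * x) ^+ 2 = 1.
  have h2 : (2 : R) != 0 by rewrite pnatr_eq0.
  by apply: (mulfI h2); rewrite mulr1 mulr_natl -[LHS](subrK 1) cosx.
move/eqP; rewrite addrC -subr_eq0 addrK sqrf_eq0.
have pi0 := pi_gt0 R.
by rewrite gt_eqF // sin_gt0_pi // mulr_gt0 //= -[ltRHS]mulr1 ltr_pM2l.
Qed.

Definition Zp_char (n : nat) (x : 'Z_n) : R[i] := e (x%:R / n%:R : R).

Section Modulus.
Variable n : nat.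
Hypothesis n_gt1 : (1 < n)%N.

Lemma Zp_char_nat (m : nat) : Zp_char (m%:R : 'Z_n) = e (m%:R / n%:R : R).
Proof.
have n0 : n%:R != 0 :> R by rewrite pnatr_eq0 -lt0n ltnW.
rewrite /Zp_char val_Zp_nat // [in RHS](divn_eq m n) natrD natrM.
by rewrite mulrDl mulfK // eD e_nat mul1r.
Qed.

Lemma Zp_charD (x y : 'Z_n) : Zp_char (x + y) = Zp_char x * Zp_char y.
Proof.
by rewrite -[x]natr_Zp -[y]natr_Zp -natrD !Zp_char_nat natrD mulrDl eD.
Qed.

Lemma Zp_char0 : Zp_char (0 : 'Z_n) = 1.
Proof. by rewrite (Zp_char_nat 0) mul0r e0. Qed.

Lemma Zp_char_int (m : int) : Zp_char (m%:~R : 'Z_n) = e (m%:~R / n%:R : R).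
Proof.
case: (intP m) => [|k|k]; first by rewrite (Zp_char_nat 0).
  exact: Zp_char_nat.
(* For negative [m], the value at [x] is the inverse of the value at [- x], which the natural case
   gives. *)
set x : 'Z_n := _%:~R; set y : R := _ / _.
have ex : Zp_char (- x) = e (- y).
  by rewrite /x /y rmorphN opprK mulrNz mulNr opprK; apply: Zp_char_nat.
have ny : e (- y) * e y = 1 by rewrite -eD addNr e0.
have ny0 : e (- y) != 0.
  by apply/eqP => h; move: ny; rewrite h mul0r => /esym/eqP; rewrite oner_eq0.
by apply: (mulfI ny0); rewrite ny -ex -Zp_charD addNr Zp_char0.
Qed.

Lemma Zp_charMn (x : 'Z_n) (m : nat) : Zp_char (x * m%:R) = Zp_char x ^+ m.
Proof.
elim: m => [|m IH]; first by rewrite mulr0 Zp_char0.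
by rewrite -natr1 mulrDr mulr1 Zp_charD IH exprSr.
Qed.

Lemma Zp_char_neq1 (x : 'Z_n) : x != 0 -> Zp_char x != 1.
Proof.
move=> x0; apply: e_neq1.
have n0 : 0 < n%:R :> R by rewrite ltr0n ltnW.
rewrite divr_gt0 ?ltr_pdivrMr //= ?mul1r ?ltr_nat ?ltr0n ?lt0n //.
by rewrite -[X in (_ < X)%N](Zp_cast n_gt1).
Qed.

Lemma sum_Zp_char (x : 'Z_n) :
  \sum_(k : 'Z_n) Zp_char (k * x) = (if x == 0 then n else 0)%:R.
Proof.
have [->|x0] := eqVneq.
  under eq_bigr => k _ do rewrite mulr0 Zp_char0.
  by rewrite sumr_const card_ord Zp_cast.
(* Shifting [k] by 1 multiplies the sum by [Zp_char x], which differs from 1. *)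
set s := \sum_k _; have: s = Zp_char x * s.
  rewrite {1}/s (reindex_inj (addrI 1)) mulr_sumr.
  by apply: eq_bigr => k _; rewrite mulrDl mul1r Zp_charD.
move/eqP; rewrite -subr_eq0 -{1}[s]mul1r -mulrBl mulf_eq0 subr_eq0 eq_sym.
by rewrite (negPf (Zp_char_neq1 x0)) => /eqP.
Qed.

End Modulus.
End AdditiveCharacter.

(** * Sums over residues and units modulo p^2, and p-th powers *)

Lemma sum_Zp (V : nmodType) (n : nat) (f : 'Z_n -> V) :
  (1 < n)%N -> \sum_x f x = \sum_(0 <= i < n) f i%:R.
Proof.
case: n f => [|[|n]] // f _.
by rewrite big_mkord; apply: eq_bigr => x _; rewrite natr_Zp.
Qed.

(** In the binomial expansion the linear term has one factor n from its coefficient and one from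
    [n%:R * y]; every later term contains (n y)^2. For n = p in Z/p^2, p-th powers thus depend only
    on the residue modulo p. *)
Lemma exprDn_natr_sqr0 (A : comPzRingType) (n : nat) (x y : A) :
  n%:R * n%:R = 0 :> A -> (x + n%:R * y) ^+ n = x ^+ n.
Proof.
case: n => [|n] nn; first by rewrite !expr0.
set c := n.+1%:R in nn *.
rewrite exprDn big_ord_recl subn0 expr0 mulr1 bin0 mulr1n big1 ?addr0 //.
move=> [[|i] lti] _; rewrite lift0 /=.
  by rewrite bin1 expr1 -mulr_natl -/c [LHS]mulrCA [c * (c * y)]mulrA
    nn mul0r mulr0.
by rewrite exprMn !exprS [c * (c * _)]mulrA nn !mul0r mulr0 mul0rn.
Qed.

Section PrimeSquare.
Variable p : nat.
Hypothesis p_prime : prime p.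
Local Notation Zq := 'Z_(p ^ 2).

Let p_gt0 : (0 < p)%N := prime_gt0 p_prime.
Let p_gt1 : (1 < p)%N := prime_gt1 p_prime.
Let q_gt1 : (1 < p ^ 2)%N.
Proof. by rewrite -(exp1n 2) ltn_exp2r. Qed.

Lemma Zp2_unit_nat (m : nat) : ((m%:R : Zq) \is a GRing.unit) = ~~ (p %| m)%N.
Proof. by rewrite unitZpE // coprime_pexpl // prime_coprime. Qed.

Lemma Zp2_unitE (x : Zq) : (x \is a GRing.unit) = ~~ (p %| x)%N.
Proof. by rewrite -{1}[x]natr_Zp Zp2_unit_nat. Qed.

Lemma Zp2_unit_int (m : int) :
  ((m%:~R : Zq) \is a GRing.unit) = ~~ (p%:Z %| m)%Z.
Proof.
rewrite {1}[m]intEsign rmorphM rmorph_sign unitrMr; last first.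
  by rewrite unitrX ?unitrN1.
by rewrite dvdzE; apply: Zp2_unit_nat.
Qed.

Lemma Zp2_pp0 : p%:R * p%:R = 0 :> Zq.
Proof. by rewrite -natrM mulnn pchar_Zp. Qed.

Lemma Zp2_pmul_mod (m n : nat) :
  m = n %[mod p] -> p%:R * m%:R = p%:R * n%:R :> Zq.
Proof.
move=> mn; rewrite -!natrM -[LHS]Zp_nat_mod // -[RHS]Zp_nat_mod //.
by rewrite -!mulnn -!muln_modr mn.
Qed.

Lemma Zp2_pmul_neq0 (m : nat) : (0 < m < p)%N -> p%:R * m%:R != 0 :> Zq.
Proof.
case/andP=> m0 mp; apply/eqP => /(congr1 (@nat_of_ord _)) /eqP.
by rewrite -natrM val_Zp_nat // -mulnn -muln_modr modn_small //= muln_eq0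
  !gtn_eqF.
Qed.

Lemma sum_Zp2 (V : nmodType) (f : Zq -> V) :
  \sum_x f x = \sum_(0 <= l < p) \sum_(0 <= j < p) f (l%:R + p%:R * j%:R).
Proof.
(* Only the summation bound is unfolded to a product; the modulus in the type [Zq] must stay
   [p ^ 2]. *)
rewrite sum_Zp // [in X in \sum_(0 <= i < X) _]expnS expn1.
rewrite big_nat_mul exchange_big; apply: eq_bigr => j _.
rewrite -{1}[(j * p)%N]add0n big_addn mulSn addnK.
by apply: eq_bigr => l _; rewrite natrD natrM mulrC.
Qed.

Lemma Zp2_unit_digits (l j : nat) :
  ((l%:R + p%:R * j%:R : Zq) \is a GRing.unit) = ~~ (p %| l)%N.
Proof. by rewrite -natrM -natrD Zp2_unit_nat dvdn_addl // dvdn_mulr. Qed.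

Lemma big_nat_ndvd (V : nmodType) (f : nat -> V) :
  \sum_(0 <= l < p) (if ~~ (p %| l)%N then f l else 0) = \sum_(1 <= l < p) f l.
Proof.
rewrite big_ltn // dvdn0 add0r; apply: eq_big_nat => l /andP[l0 lp].
by rewrite gtnNdvd.
Qed.

(** The p lifts l + p j of a residue l share their p-th power, and they are units exactly when p
    does not divide l. *)
Lemma sum_Zp2_unit_expp (V : nmodType) (f : Zq -> V) :
  \sum_(x | x \is a GRing.unit) f (x ^+ p) =
  (\sum_(1 <= l < p) f (l%:R ^+ p)) *+ p.
Proof.
rewrite big_mkcond sum_Zp2 -sumrMnl -big_nat_ndvd; apply: eq_bigr => l _.
under eq_bigr => j _ do rewrite Zp2_unit_digits (exprDn_natr_sqr0 _ _ Zp2_pp0).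
by rewrite sumr_const_nat subn0; case: ifP => // _; rewrite mul0rn.
Qed.

Lemma sum_Zp2_unit_split (V : nmodType) (f : Zq -> V) :
  \sum_x f x =
  \sum_(x | x \is a GRing.unit) f x + \sum_(0 <= j < p) f (p%:R * j%:R).
Proof.
rewrite (bigID (fun x : Zq => x \is a GRing.unit)) /=; congr (_ + _).
rewrite big_mkcond sum_Zp2 [LHS]big_ltn // [X in _ + X]big_nat.
rewrite [X in _ + X]big1 ?addr0.
  by apply: eq_bigr => j _; rewrite Zp2_unit_digits dvdn0 add0r.
move=> l /andP[l0 lp]; apply: big1 => j _.
by rewrite Zp2_unit_digits gtnNdvd.
Qed.

(** The unit group has order phi(p^2) = (p - 1) p, so these powers of g run through it once. The
    form [p.-1 * p] of the bound allows a later splitting into p - 1 blocks of length p. *)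
Lemma sum_Zp2_unit_gen (V : nmodType) (g : int) (f : Zq -> V) :
  primitive_root_mod (p ^ 2) g ->
  \sum_(x | x \is a GRing.unit) f x =
  \sum_(0 <= i < p.-1 * p) f (g%:~R ^+ i).
Proof.
case=> u ug gen_u.
have ou : #[u]%g = (p.-1 * p)%N.
  rewrite orderE -(eqP gen_u) [LHS]card_units_Zp ?expn_gt0 ?p_gt0 //.
  by rewrite totient_pfactor // expn1.
(* Moves the sum to the subtype [{unit Zq}], in which the generator lives. *)
rewrite (reindex_omap (val : {unit Zq} -> Zq) insub) /=; last first.
  by move=> x ux; rewrite insubT.
rewrite (eq_bigl (fun v => v \in <[u]>%g)); last first.
  by move=> v; rewrite valK eqxx andbT (valP v) -(eqP gen_u) inE.
have -> : <[u]>%g = [set (u ^+ (i : nat))%g | i : 'I_(p.-1 * p)].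
  apply/setP => v; apply/idP/imsetP => [/cyclePmin|[i _ ->]].
    by case=> i; rewrite ou => lti ->; exists (Ordinal lti).
  exact: mem_cycle.
rewrite big_imset /=.
  by rewrite big_mkord; apply: eq_bigr => i _; rewrite FinRing.val_unitX /= ug.
move=> i j _ _ /eqP; rewrite eq_expg_mod_order ou !modn_small // => /eqP.
exact: val_inj.
Qed.

(** * Heilbronn sums as functions on Z/p^2 *)

Section HeilbronnSum.
Variable R : realType.
Local Notation chi := (Zp_char R).

Definition Zp2_heilbronn (k : Zq) : R[i] :=
  \sum_(1 <= l < p) chi (k * l%:R ^+ p).
Local Notation H := Zp2_heilbronn.

Lemma heilbronn_Zp2 (a : int) : heilbronn R p a = H a%:~R.
Proof.
by apply: eq_bigr => l _; rewrite -natrX -Zp_char_int // rmorphM rmorphXn.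
Qed.

Lemma Zp2_heilbronn_units (k : Zq) :
  \sum_(x | x \is a GRing.unit) chi (k * x ^+ p) = H k *+ p.
Proof. exact: (sum_Zp2_unit_expp (fun y => chi (k * y))). Qed.

Lemma Zp2_heilbronn0 : H 0 = p%:R - 1.
Proof.
rewrite /H (eq_bigr (fun=> 1)) => [|l _]; last by rewrite mul0r Zp_char0.
by rewrite sumr_const_nat natrB.
Qed.

(** With w = chi (p y), the congruence l^p = l mod p makes this the sum of w^l over 0 < l < p, where
    w^p = 1 and w is not 1; adding w^0 would give 0. *)
Lemma Zp2_heilbronn_pmul (y : Zq) : p%:R * y != 0 -> H (p%:R * y) = -1.
Proof.
move=> py0; have py1 := Zp_char_neq1 R q_gt1 py0.
have -> : H (p%:R * y) = \sum_(1 <= l < p) chi (p%:R * y) ^+ l.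
  apply: eq_bigr => l _; rewrite -Zp_charMn // -natrX.
  rewrite ![p%:R * y * _]mulrAC; congr (chi (_ * _)).
  exact/Zp2_pmul_mod/fermat_little.
have /esym/eqP := subrX1 (chi (p%:R * y)) p.
rewrite -Zp_charMn // mulrAC Zp2_pp0 mul0r Zp_char0 // subrr.
rewrite mulf_eq0 subr_eq0 (negPf py1) -(big_mkord xpredT (GRing.exp _)).
by rewrite big_ltn // expr0 addrC addr_eq0 => /eqP.
Qed.

(** By [Zp2_heilbronn_units], p H is a sum over all units, which x -> u x permutes; the factor p
    cancels in [R[i]]. *)
Lemma Zp2_heilbronn_expp (k u : Zq) :
  u \is a GRing.unit -> H (k * u ^+ p) = H k.
Proof.
move=> uu; have p0 : p%:R != 0 :> R[i] by rewrite pnatr_eq0 -lt0n.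
apply: (mulIf p0); rewrite !mulr_natr -!Zp2_heilbronn_units.
rewrite [RHS](reindex_inj (mulrI uu)); apply: eq_big => x.
  by rewrite unitrMr.
by move=> _; rewrite exprMn mulrA.
Qed.

End HeilbronnSum.

(** * Counting solutions with unit coordinates *)

Section Counting.
Variables (R : realType) (g a b c : int).
Hypotheses (p_odd : odd p) (g_prim : primitive_root_mod (p ^ 2) g).
Hypothesis p_abc : ~~ (p%:Z %| a * b * c)%Z.
Local Notation H := (Zp2_heilbronn R).
Local Notation unit := (fun x : Zq => x \is a GRing.unit).
Local Notation T k := (H (a%:~R * k) * H (b%:~R * k) * H (c%:~R * k)).

Let abc_unit : [/\ (a%:~R : Zq) \is a GRing.unit, (b%:~R : Zq) \is a GRing.unit
                 & (c%:~R : Zq) \is a GRing.unit].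
Proof.
by apply/and3P; rewrite andbA -!unitrM -!intrM Zp2_unit_int.
Qed.

Lemma card_solutions (A : pzSemiRingType) :
  #|solutions p a b c|%:R =
  \sum_(x | unit x) \sum_(y | unit y) \sum_(z | unit z)
    (a%:~R * x ^+ p + b%:~R * y ^+ p == c%:~R * z ^+ p)%:R :> A.
Proof.
rewrite pair_big /= pair_big -sum1_card natr_sum big_mkcond [RHS]big_mkcond.
apply: eq_bigr => [[[x y] z]] _ /=; rewrite inE !Zp2_unitE -!negb_or.
by rewrite !Euclid_dvdM //; case: eqP => _; case: ifP.
Qed.

Lemma sum_heilbronn3 :
  (\sum_k T k) *+ p ^ 3 = (p ^ 2)%:R * #|solutions p a b c|%:R.
Proof.
(* One factor p goes into each Heilbronn sum, which becomes a sum over units. *)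
transitivity (\sum_k ((\sum_(x | unit x) Zp_char R (a%:~R * k * x ^+ p))
    * (\sum_(y | unit y) Zp_char R (b%:~R * k * y ^+ p))
    * (\sum_(z | unit z) Zp_char R (c%:~R * k * z ^+ p)))).
  rewrite -sumrMnl; apply: eq_bigr => k _; rewrite !Zp2_heilbronn_units.
  by rewrite !(mulrnAl, mulrnAr) -!mulrnA; congr (_ *+ _);
    rewrite !expnS expn0 muln1.
rewrite card_solutions mulr_sumr.
under eq_bigr => k _ do rewrite -mulrA mulr_suml.
rewrite exchange_big; apply: eq_bigr => x _ /=.
rewrite mulr_sumr.
under eq_bigr => k _ do rewrite mulr_suml mulr_sumr.
rewrite exchange_big; apply: eq_bigr => y _ /=.
rewrite mulr_sumr.
under eq_bigr => k _ do rewrite !mulr_sumr.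
(* Replacing z by -z turns + c z^p into - c z^p, since p is odd; the sum over k then detects the
   congruence. *)
rewrite exchange_big [LHS](reindex_inj (@oppr_inj _)) /=.
apply: eq_big => [z|z _]; first by rewrite unitrN.
transitivity (\sum_k Zp_char R
    (k * (a%:~R * x ^+ p + b%:~R * y ^+ p - c%:~R * z ^+ p))).
  apply: eq_bigr => k _; rewrite -!Zp_charD // exprNn -signr_odd p_odd.
  by congr (Zp_char R _); ring.
by rewrite sum_Zp_char // subr_eq0; case: eqP => _; rewrite ?mulr1 ?mulr0.
Qed.

(* Scaling by units acts freely on the solutions, which reduces to z = 1; then
   x ^+ p and y ^+ p depend only on the residues of x and y mod p. *)
Lemma card_solutions_dvd :
  exists k : nat,
    #|solutions p a b c|%:R = p%:R ^+ 3 * (p%:R - 1) * k%:R :> R[i].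
Proof.
(* The witness counts the pairs (l, m) of nonzero residues modulo p that solve the congruence modulo
   p^2 with z = 1. *)
exists (\sum_(1 <= l < p) \sum_(1 <= m < p)
  ((a%:~R * l%:R ^+ p + b%:~R * m%:R ^+ p)%R == c%:~R%R :> Zq))%N.
have -> : #|solutions p a b c|%:R = \sum_(z | unit z)
   \sum_(x | unit x) \sum_(y | unit y)
     (a%:~R * x ^+ p + b%:~R * y ^+ p == c%:~R)%:R :> R[i].
  rewrite card_solutions.
  under eq_bigr => x _ do rewrite exchange_big.
  rewrite exchange_big; apply: eq_bigr => z uz /=.
  (* Substituting x z and y z for x and y brings out z^p, a unit that cancels. *)
  rewrite (reindex_inj (mulIr uz)); apply: eq_big => [x|x _].
    by rewrite unitrMl.
  rewrite (reindex_inj (mulIr uz)); apply: eq_big => [y|y _].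
    by rewrite unitrMl.
  by rewrite !exprMn !mulrA -mulrDl (inj_eq (mulIr _)) // unitrX.
(* The sum over z is constant and yields p (p - 1); the sums over x and y contribute one further
   factor p each. *)
rewrite (sum_Zp2_unit_expp (fun=> _)) sumr_const_nat natr_sum.
rewrite (sum_Zp2_unit_expp (fun u => \sum_(y | unit y)
     (a%:~R * u + b%:~R * y ^+ p == c%:~R)%:R)).
under [in LHS]eq_bigr => l _ do rewrite (sum_Zp2_unit_expp (fun v =>
     (a%:~R * l%:R ^+ p + b%:~R * v == c%:~R)%:R : R[i])).
under [in RHS]eq_bigr => l _ do rewrite natr_sum.
rewrite sumrMnl -!mulrnA -[LHS]mulr_natl !natrM natrB //.
by congr (_ * _); ring.
Qed.

(* g ^+ p is a p-th power, so T (g ^+ i) has period p in i; the multiples of p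
   contribute (p - 1) ^+ 3 for k = 0 and -1 for each of the p - 1 others. *)
Lemma sum_heilbronn3_split :
  \sum_k T k =
  (p%:R - 1) * (\sum_(1 <= l < p.+1) heilbronn R p (a * g ^+ l)
                         * heilbronn R p (b * g ^+ l)
                         * heilbronn R p (c * g ^+ l)
    + (p%:R - 1) ^+ 2 - 1).
Proof.
have [ua ub uc] := abc_unit.
have ug : (g%:~R : Zq) \is a GRing.unit by case: g_prim => u <- _; exact: valP.
have HN1 (x j : Zq) :
    x \is a GRing.unit -> p%:R * j != 0 -> H (x * (p%:R * j)) = -1.
  move=> ux pj; rewrite mulrCA Zp2_heilbronn_pmul // mulrCA.
  by apply: contra pj => /eqP xpj; rewrite -(mulKr ux (_ * j)) xpj mulr0.
have p1 : (p.-1)%:R = p%:R - 1 :> R[i] by rewrite -subn1 natrB.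
rewrite sum_Zp2_unit_split [X in _ + X]big_ltn // !mulr0 !Zp2_heilbronn0.
rewrite [X in _ + (_ + X)]big_nat.
rewrite [X in _ + (_ + X)](eq_bigr (fun=> -1)) => [|j]; last first.
  by move/Zp2_pmul_neq0 => pj; rewrite !HN1 // !mulrN1 opprK.
rewrite -big_nat sumr_const_nat subn1 -[-1 *+ _]mulr_natr p1.
rewrite (sum_Zp2_unit_gen _ g_prim) big_nat_mul.
(* The range 1..p becomes 0..p-1: the terms at l = p and l = 0 agree because g^p is the p-th power
   of a unit. *)
have -> : \sum_(1 <= l < p.+1) heilbronn R p (a * g ^+ l)
    * heilbronn R p (b * g ^+ l) * heilbronn R p (c * g ^+ l) =
    \sum_(0 <= l < p) T (g%:~R ^+ l).
  under eq_bigr => l _ do rewrite !heilbronn_Zp2 !rmorphM !rmorphXn.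
  rewrite big_nat_recr // [in RHS]big_ltn // addrC expr0 !Zp2_heilbronn_expp //.
  by rewrite !mulr1.
rewrite (eq_bigr (fun=> \sum_(0 <= l < p) T (g%:~R ^+ l))) => [|i _].
  rewrite sumr_const_nat subn0 -[X in X + _]mulr_natl p1.
  by move: (\sum_(_ <= _ < _) _) (p%:R : R[i]) => s t; ring.
rewrite -{1}[(i * p)%N]add0n big_addn mulSn addnK; apply: eq_bigr => l _.
by rewrite exprD exprM !mulrA !Zp2_heilbronn_expp // unitrX.
Qed.

End Counting.

(** * Integer solutions and the final assembly *)

Lemma int_solution_Zp2 (a b c x y z : int) :
  ~~ (p%:Z %| x * y * z)%Z -> a * x ^+ p + b * y ^+ p = c * z ^+ p ->
  (x%:~R, y%:~R, z%:~R) \in solutions p a b c.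
Proof.
rewrite -Zp2_unit_int !rmorphM !unitrM -andbA => /and3P[ux uy uz] xyz.
rewrite inE !Euclid_dvdM // !negb_or -!Zp2_unitE ux uy uz !andbT.
by apply/eqP; rewrite -!rmorphXn -!rmorphM -rmorphD xyz.
Qed.

End PrimeSquare.

Theorem theorem4p1 (R : realType) (p : nat) (g a b c : int)
    (p_prime : prime p) (p_odd : odd p)
    (g_prim : primitive_root_mod (p ^ 2) g)
    (p_abc : ~~ (p%:Z %| a * b * c)%Z) :
  [/\ exists k : nat, F R p g a b c = k%:R,
      #|solutions p a b c|%:R = p%:R ^+ 3 * (p%:R - 1) * F R p g a b c
    & F R p g a b c = 0 ->
      ~ exists x y z : int,
          ~~ (p%:Z %| x * y * z)%Z
          /\ a * x ^+ p + b * y ^+ p = c * z ^+ p].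
Proof.
have p0 : p%:R != 0 :> R[i] by rewrite pnatr_eq0 -lt0n prime_gt0.
have p1 : p%:R - 1 != 0 :> R[i].
  by rewrite subr_eq0 pnatr_eq1 gtn_eqF // prime_gt1.
have cardE : #|solutions p a b c|%:R = p%:R ^+ 3 * (p%:R - 1) * F R p g a b c.
  apply: (mulfI (expf_neq0 2 p0)); rewrite -[in LHS]natrX.
  rewrite -sum_heilbronn3 // (sum_heilbronn3_split p_prime R g_prim p_abc).
  rewrite -mulr_natl natrX /F.
  (* As (p - 1)^2 - 1 = p^2 - 2 p, the second factor from [sum_heilbronn3_split] is p^2 F. *)
  by set s := \sum_(_ <= _ < _) _; move: s (p%:R : R[i]) p0 => s t t0; field.
split=> // [|F0 [x [y [z [xyz eq_xyz]]]]].
  (* The count is p^3 (p - 1) F and also p^3 (p - 1) k with k natural, so F = k after cancelling. *)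
  have [k kE] := card_solutions_dvd p_prime R a b c; exists k.
  by apply: (mulfI (mulf_neq0 (expf_neq0 3 p0) p1)); rewrite -cardE.
(* An integer solution would reduce to an element of [solutions p a b c], which is empty when F =
   0. *)
have := int_solution_Zp2 p_prime xyz eq_xyz.
move/eqP: cardE; rewrite F0 mulr0 pnatr_eq0 cards_eq0 => /eqP->.
by rewrite inE.
Qed.
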